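(* Let $(X,d_X)$ be a finite metric space and $D\ge 1$. If $(X,d_X)$ admits a stochastic $D$-embedding into dominating tree-metrics, then $\mathsf{La}(X)$ embeds bi-Lipschitzly into $L_1$ with distortion at most $6D$.
   Context: For a finite metric space $(X,d_X)$, points $x,y\in X$ and $C\subset X$, $\mathrm{tsp}_X(x,C,y)$ is the minimum of $\sum_{i=1}^n d_X(x_{i-1},x_i)$ over all finite sequences $x_0,\dots,x_n$ ($n\ge0$) in $X$ with $x_0=x$, $x_n=y$, $C\subset\{x_0,\dots,x_n\}$. The lamplighter metric space $\mathsf{La}(X)$ is the set of pairs $(A,x)$, with $A$ a finite subset of $X$ and $x\in X$, with the metric $d_{\mathsf{La}(X)}((A,x),(B,y))=\mathrm{tsp}_X(x,A\triangle B,y)+|A\triangle B|$. A metric $d_w$ is supported on a graph $G=(V,E)$ if it is the shortest path metric on $V$ with respect to some weight function $w\colon E\to[0,\infty)$ (always assumed reduced: $d_w(x,y)=w((x,y))$ for $(x,y)\in E$). A tree-metric is a metric supported on a finite tree. $(X,d_X)$ admits a stochastic $D$-embedding into dominating tree-metrics if there exist $k\ge1$, non-negative numbers $p_1,\dots,p_k$ with $\sum_{i=1}^k p_i=1$, and maps $f_i\colon X\to(Y_i,d_i)$, where each $d_i$ is a tree-metric, such that for all $x,y\in X$: $d_i(f_i(x),f_i(y))\ge d_X(x,y)$ for all $i$, and $\sum_{i=1}^k p_i d_i(f_i(x),f_i(y))\le D\,d_X(x,y)$. A metric space $(M,d_M)$ embeds bi-Lipschitzly into $L_1$ with distortion at most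 $D'$ if there are $s>0$ and $f\colon M\to L_1$ with $s\,d_M(x,y)\le\|f(x)-f(y)\|_1\le D's\,d_M(x,y)$ for all $x,y\in M$. *)

(* Defs.v *)
From HB Require Import structures.
From mathcomp Require Import all_boot all_order all_algebra.
From mathcomp Require Import all_classical all_reals all_analysis.

Set Implicit Arguments.
Unset Strict Implicit.
Unset Printing Implicit Defensive.
Import Order.TTheory GRing.Theory Num.Theory.
Import numFieldNormedType.Exports.
Local Open Scope classical_set_scope.
Local Open Scope ring_scope.

#[short(type="finMetricType")]
HB.structure Definition FinMetric (R : numDomainType) :=
  {X of Finite X & Metric R X}.

(* At most a singleton, like [infimums]. *)
Definition minimums (R : realType) (A : set R) : set R := A `&` lbound A.

(* The walk [x :: s] visits x, s_1, ..., s_n; its length is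
   w x s_1 + w s_1 s_2 + ... + w s_(n-1) s_n. *)
Definition walk_length (R : realType) (T : Type) (w : T -> T -> R)
    (x : T) (s : seq T) : R :=
  \sum_(c <- pairmap w x s) c.

Section Tsp.
Context {R : realType} {X : finMetricType R}.
Implicit Types (x y z : X) (s t : seq X) (A B C : {set X}).

Definition tours x C y : set (seq X) :=
  [set s | last x s = y /\ {subset C <= x :: s}].

Definition tour_lengths x C y : set R :=
  [set walk_length mdist x s | s in tours x C y].

(* The infimum is attained, see [tsp_minimum]. *)
Definition tsp x C y : R := inf (tour_lengths x C y).

Local Notation len := (walk_length (@mdist R X)).

Lemma walk_length_cons x z s : len x (z :: s) = mdist x z + len z s.
Proof. by rewrite /walk_length /= big_cons. Qed.

Lemma walk_length_nil x : len x [::] = 0.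
Proof. by rewrite /walk_length big_nil. Qed.

Lemma walk_length_ge0 x s : 0 <= len x s.
Proof.
elim: s x => [|z s IH] x; first by rewrite walk_length_nil.
by rewrite walk_length_cons addr_ge0// mdist_ge0.
Qed.

Lemma walk_length_cat x s t : len x (s ++ t) = len x s + len (last x s) t.
Proof.
elim: s x => [|z s IH] x /=; first by rewrite walk_length_nil add0r.
by rewrite !walk_length_cons IH addrA.
Qed.

Lemma mdist_le_walk_length x s : mdist x (last x s) <= len x s.
Proof.
elim: s x => [|z s IH] x /=; first by rewrite mdistxx walk_length_nil.
by rewrite walk_length_cons (le_trans (metric_triangle _ z _))// lerD2l.
Qed.

Lemma walk_length_subseq x s t : subseq t s ->
  len x t + mdist (last x t) (last x s) <= len x s.
Proof.
elim: s x t => [|z s IH] x [|u t] //= H.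
- by rewrite walk_length_nil mdistxx addr0.
- by rewrite walk_length_nil add0r (mdist_le_walk_length x (z :: s)).
- rewrite !walk_length_cons; move: H; have [->|_] := eqVneq u z => H.
    by rewrite -addrA lerD2l; exact: IH.
  have /= := IH z (u :: t) H; rewrite walk_length_cons => H2.
  apply: (@le_trans _ _ (mdist x z + (mdist z u + len u t
    + mdist (last u t) (last z s)))); last by rewrite lerD2l.
  by rewrite !addrA !lerD2r metric_triangle.
Qed.

Lemma short_tour x C y s : tours x C y s ->
  exists t, [/\ tours x C y t, (size t <= #|X|.+1)%N & len x t <= len x s].
Proof.
case/lastP: s => [|s z] [].
  by move=> xy Cx; exists [::].
rewrite last_rcons => -> Cs; exists (rcons (undup s) y).
have sub : subseq (rcons (undup s) y) (rcons s y).
  by rewrite -!cats1 cat_subseq// undup_subseq.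
split.
- split=> [|c /Cs]; first by rewrite last_rcons.
  by rewrite !inE !mem_rcons !inE mem_undup.
- by rewrite size_rcons ltnS -(card_uniqP (undup_uniq s)) max_card.
- have := walk_length_subseq x sub.
  by rewrite !last_rcons mdistxx addr0.
Qed.

Lemma tours_nonempty x C y : tours x C y !=set0.
Proof.
exists (rcons (enum C) y); split; first by rewrite last_rcons.
by move=> c cC; rewrite inE mem_rcons inE mem_enum cC !orbT.
Qed.

Lemma tsp_minimum x C y : minimums (tour_lengths x C y) (tsp x C y).
Proof.
pose P (b : (#|X|.+1).-bseq X) := `[< tours x C y b >].
have [s0 /short_tour[t0 [t0t t0s _]]] := tours_nonempty x C y.
have P0 : P (Bseq t0s) by apply/asboolP.
case: (@arg_minP _ _ _ (Bseq t0s) P (fun b => len x b) P0) => b /asboolP bt bmin.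
have mn : minimums (tour_lengths x C y) (len x b).
  split; first by exists b.
  move=> _ [s /short_tour[t [tt ts tl]] <-]; apply: le_trans tl.
  by apply: (bmin (Bseq ts)); apply/asboolP.
suff -> : tsp x C y = len x b by [].
apply/eqP; rewrite eq_le; apply/andP; split.
  by apply: ge_inf; [exists (len x b); case: mn|case: mn].
by apply: lb_le_inf; [exists (len x b); case: mn|case: mn].
Qed.

Lemma tspP x C y : exists2 s, tours x C y s & tsp x C y = len x s.
Proof. by have [[s ss <-] _] := tsp_minimum x C y; exists s. Qed.

Lemma tsp_le x C y s : tours x C y s -> tsp x C y <= len x s.
Proof. by move=> ss; have [_] := tsp_minimum x C y; apply; exists s. Qed.

Lemma tsp_ge0 x C y : 0 <= tsp x C y.
Proof. by have [s _ ->] := tspP x C y; exact: walk_length_ge0. Qed.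

Lemma walk_length_rev x s : len (last x s) (rev (belast x s)) = len x s.
Proof.
elim: s x => [|z s IH] x /=; first by rewrite !walk_length_nil.
rewrite rev_cons -cats1 walk_length_cat IH !walk_length_cons walk_length_nil.
rewrite addr0 addrC; congr (_ + _); rewrite metric_sym; congr mdist.
by case: s {IH} => //= u s; rewrite rev_cons last_rcons.
Qed.

Lemma tsp_sym x C y : tsp x C y = tsp y C x.
Proof.
suff H u v : tsp u C v <= tsp v C u by apply/eqP; rewrite eq_le !H.
have [s [<- Cs] ->] := tspP v C u.
rewrite -walk_length_rev; apply: tsp_le; split.
  by case: s Cs => //= z s _; rewrite rev_cons last_rcons.
move=> c /Cs; rewrite lastI mem_rcons !inE mem_rev.
by [].
Qed.

Lemma tsp_triangle x y z C1 C2 C : C \subset C1 :|: C2 ->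
  tsp x C z <= tsp x C1 y + tsp y C2 z.
Proof.
move=> /fintype.subsetP CC.
have [s [<- Cs] ->] := tspP x C1 y; have [t [<- Ct] ->] := tspP (last x s) C2 z.
rewrite -walk_length_cat; apply: tsp_le; split; first by rewrite last_cat.
move=> c /CC; rewrite -cat_cons mem_cat => /setUP[/Cs ->//|/Ct].
by rewrite inE => /predU1P[->|->]; rewrite ?mem_last ?orbT.
Qed.

End Tsp.

Definition symdiff (T : finType) (A B : {set T}) : {set T} :=
  (A :\: B) :|: (B :\: A).

(* A point (A, x) of the lamplighter space: as X is finite, A ranges over all
   subsets of X. *)
Definition lamplighter (R : realType) (X : finMetricType R) : Type :=
  ({set X} * X)%type.

Definition lamplighter_dist (R : realType) (X : finMetricType R)
    (a b : lamplighter X) : R :=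
  tsp a.2 (symdiff a.1 b.1) b.2 + #|symdiff a.1 b.1|%:R.

Section LamplighterMetric.
Context {R : realType} {X : finMetricType R}.
Local Notation La := (lamplighter X).
Local Notation d := (@lamplighter_dist R X).

Lemma symdiffxx (A : {set X}) : symdiff A A = finset.set0.
Proof. by rewrite /symdiff finset.setDv finset.setU0. Qed.

Lemma symdiffC (A B : {set X}) : symdiff A B = symdiff B A.
Proof. by rewrite /symdiff finset.setUC. Qed.

Lemma symdiff_sub (A B C : {set X}) :
  symdiff A C \subset symdiff A B :|: symdiff B C.
Proof.
apply/fintype.subsetP => c; rewrite !inE.
by case: (c \in A); case: (c \in B); case: (c \in C).
Qed.

Lemma lamplighter_distxx (a : La) : d a a = 0.
Proof.
rewrite /lamplighter_dist symdiffxx cards0 addr0; apply/eqP.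
rewrite eq_le tsp_ge0 andbT -(walk_length_nil a.2); apply: tsp_le.
by split=> // c; rewrite inE.
Qed.

Lemma lamplighter_dist_positivity (a b : La) : d a b = 0 -> a = b.
Proof.
case: a b => [A x] [B y] /eqP; rewrite /lamplighter_dist /=.
rewrite paddr_eq0 ?tsp_ge0// pnatr_eq0 cards_eq0 => /andP[/eqP t0 /eqP D0].
congr pair.
  apply/setP => c; have /setP/(_ c) := D0; rewrite !inE.
  by case: (c \in A); case: (c \in B).
have [s [sy _] ts] := tspP x (symdiff A B) y.
apply/(@mdist_positivity R); apply/eqP; rewrite eq_le mdist_ge0 andbT.
by rewrite -t0 ts -sy mdist_le_walk_length.
Qed.

Lemma lamplighter_dist_sym (a b : La) : d a b = d b a.
Proof. by rewrite /lamplighter_dist symdiffC tsp_sym. Qed.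

Lemma lamplighter_dist_triangle (b a c : La) : d a c <= d a b + d b c.
Proof.
rewrite /lamplighter_dist addrACA lerD//.
  exact/tsp_triangle/symdiff_sub.
by rewrite -natrD ler_nat (leq_trans (subset_leq_card (symdiff_sub _ b.1 _)))//
  cardsU leq_subr.
Qed.

HB.instance Definition _ := Finite.on La.
HB.instance Definition _ := @isMetric.Build R La d lamplighter_distxx
  lamplighter_dist_positivity lamplighter_dist_sym lamplighter_dist_triangle.

Lemma lamplighter_mdistE (a b : La) : mdist a b =
  tsp a.2 (symdiff a.1 b.1) b.2 + #|symdiff a.1 b.1|%:R.
Proof. by []. Qed.

End LamplighterMetric.

(* The finite simple graph with vertex set V and adjacency relation e is a
   tree. *)
Definition is_tree (V : finType) (e : rel V) : Prop :=
  [/\ symmetric e, irreflexive e, (0 < #|V|)%N,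
      forall x y, connect e x y
    & forall c : seq V, (2 < size c)%N -> ~~ ucycleb e c].

(* Only the values of w on the edges of e matter; an undirected edge has one
   weight, whence the symmetry condition. The last condition says that w is
   reduced. *)
Definition supported_on (R : realType) (V : finMetricType R) (e : rel V) :
    Prop :=
  exists w : V -> V -> R,
    [/\ forall x y, e x y -> 0 <= w x y,
        forall x y, e x y -> w x y = w y x,
        forall x y, minimums
          [set walk_length w x s | s in [set s | path e x s /\ last x s = y]]
          (mdist x y)
      & forall x y, e x y -> mdist x y = w x y].

Definition tree_metric (R : realType) (V : finMetricType R) : Prop :=
  exists2 e : rel V, is_tree e & supported_on e.

Definition stochastic_tree_embeddable (R : realType) (X : finMetricType R)
    (D : R) : Prop :=
  exists (k : nat) (p : 'I_k -> R) (Y : 'I_k -> finMetricType R)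
         (f : forall i, X -> Y i),
    [/\ (0 < k)%N, forall i, 0 <= p i, \sum_(i < k) p i = 1,
        forall i, tree_metric (Y i)
      & forall x y : X,
          (forall i, mdist x y <= mdist (f i x) (f i y)) /\
          \sum_(i < k) p i * mdist (f i x) (f i y) <= D * mdist x y].

Definition lebesgue01 (R : realType) :
    {measure set (measurableTypeR R) -> \bar R} :=
  mrestr lebesgue_measure (measurable_itv `[0%R : R, 1%R]).

(* L_1 = L_1([0, 1]); elements are classes of functions modulo a.e. equality,
   which coerce to a representative. *)
Definition L1 (R : realType) := LspaceType1 (lebesgue01 R).

Definition L1_dist (R : realType) (g h : L1 R) : \bar R :=
  ('N[lebesgue01 R]_1[(fun t => (g t - h t)%:E)])%E.

Definition bilipschitz_embeds_in_L1 (R : realType) (M : metricType R) (D : R) :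
    Prop :=
  exists (s : R) (f : M -> L1 R), 0 < s /\
    forall x y : M,
      ((s * mdist x y)%:E <= L1_dist (f x) (f y))%E /\
      (L1_dist (f x) (f y) <= (D * s * mdist x y)%:E)%E.

(* Main.v *)
Require Import Defs.
From HB Require Import structures.
From mathcomp Require Import all_boot all_order all_algebra.
From mathcomp Require Import all_classical all_reals all_analysis.
From mathcomp Require Import measurable_realfun ring lra.

(* Removing an edge from a weighted tree leaves two sides.  A shortest tour from
   x to y through C crosses every edge of the subtree spanned by C, x and y,
   and there is a tour crossing each of them at most twice; so tsp(x, C, y) is
   at least H and at most 2 H, where H is the total weight of that subtree.
   Label (A, x), for each edge, by the side containing x together with the part
   of A on the other side: the labels of (A, x) and (B, y) differ exactly when
   the edge lies in the subtree spanned by x, y and the symmetric difference of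
   A and B.  Hence H is a weighted sum of discrete metrics, which embeds
   isometrically in L_1, as does the cardinality of the symmetric difference.
   Averaging over the stochastic tree embedding gives distortion 2 D. *)

Set Implicit Arguments.
Unset Strict Implicit.
Unset Printing Implicit Defensive.
Import Order.TTheory GRing.Theory Num.Theory.
Local Open Scope ring_scope.

(** * Finite l_1 metrics in L_1 *)

Section L1Class.
Context {R : realType}.
Local Notation mu := (lebesgue01 R).
Local Notation RB := (measurableTypeR R).
Local Notation AE := (@aeEqMfun _ _ R RB RB mu).

Lemma Lnorm1_ae_eq (f g : RB -> \bar R) :
  measurable_fun setT f -> measurable_fun setT g ->
  {ae mu, forall t, f t = g t} -> ('N[mu]_1[f] = 'N[mu]_1[g])%E.
Proof.
move=> mf mg fg; rewrite !Lnorm1; apply: ge0_ae_eq_integral => //.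
- exact: measurableT_comp.
- exact: measurableT_comp.
- by apply: filterS fg => t + _ => ->.
Qed.

Lemma measurable_L1 (F : L1 R) : measurable_fun setT (fun t : RB => F t).
Proof. exact: (measurable_funPT (repr (F : AE))). Qed.

(** The representative of the class of [f] agrees with [f] almost everywhere, so it inherits the
    finite norm. *)
Lemma L1_class (f : RB -> RB) : measurable_fun setT f ->
  ('N[mu]_1[(fun t => (f t)%:E)] < +oo)%E ->
  exists F : L1 R, {ae mu, forall t, F t = f t}.
Proof.
move=> mf fin.
pose fm : {mfun RB >-> RB} := mfun_Sub (mem_set mf).
pose g : AE := (\pi_AE fm)%qT.
have gf : {ae mu, forall t, g t = f t}.
  have : (\pi_AE (repr g) == \pi_AE fm)%qT by rewrite reprK.
  by rewrite eqmodE => /asboolP; apply: filterS => t /(_ I).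
have gfin : finite_norm mu 1%E g.
  rewrite /finite_norm (Lnorm1_ae_eq (g := fun t => (f t)%:E)) //.
  - by apply/measurable_EFinP; exact: (measurable_funPT (repr g)).
  - by apply/measurable_EFinP.
  - by apply: filterS gf => t /= ->.
pose F : L1 R := HB.pack g (isFinLebesgue.Build _ RB R mu 1%E (lexx _) g gfin).
by exists F.
Qed.
End L1Class.

(** * Step functions on equal subintervals of the unit interval *)

Section StepFunctions.
Context {R : realType} (n : nat).
Local Notation mu := (lebesgue01 R).
Local Notation RB := (measurableTypeR R).
Implicit Types (u v : 'I_n -> R) (j : 'I_n).

(** Half-open, so that distinct subintervals are disjoint. *)
Definition subinterval j : set RB := [set` `[j%:R / n%:R, j.+1%:R / n%:R[].

Definition step u (t : RB) : RB := \sum_(j < n) u j * \1_(subinterval j) t.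

Lemma measurable_subinterval j : measurable (subinterval j : set RB).
Proof. exact: measurable_itv. Qed.

Lemma measurable_step u : measurable_fun setT (step u).
Proof.
apply: measurable_sum => j; apply: measurable_funM => //.
by apply: measurable_indic; exact: measurable_subinterval.
Qed.

Lemma subinterval_disjoint i j t : subinterval i t -> subinterval j t -> i = j.
Proof.
rewrite /subinterval /= !in_itv /= => /andP[i1 i2] /andP[j1 j2].
have n0 : 0 < n%:R :> R by rewrite ltr0n (leq_ltn_trans _ (ltn_ord i)).
have h (a b : 'I_n) : a%:R / n%:R <= t -> t < b.+1%:R / n%:R -> (a <= b)%N.
  move=> at_ tb; have := le_lt_trans at_ tb.
  by rewrite ltr_pM2r ?invr_gt0// ltr_nat.
by apply/val_inj/eqP; rewrite eqn_leq !h.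
Qed.

Lemma step_in u i t : subinterval i t -> step u t = u i.
Proof.
move=> it; rewrite /step (bigD1 i)//= big1 => [|j ji].
  by rewrite addr0 indicE mem_set// mulr1.
rewrite indicE memNset ?mulr0// => jt.
by move: ji; rewrite (subinterval_disjoint jt it) eqxx.
Qed.

Lemma step_out u t : ~ (exists i, subinterval i t) -> step u t = 0.
Proof.
move=> no; rewrite /step big1// => j _; rewrite indicE memNset ?mulr0// => jt.
by apply: no; exists j.
Qed.

Lemma normr_step u t : `|step u t| = step (fun j => `|u j|) t.
Proof.
have [[i it]|no] := pselect (exists i, subinterval i t).
  by rewrite !(step_in _ it).
by rewrite !step_out// normr0.
Qed.

Lemma lebesgue01_subinterval j : mu (subinterval j) = (n%:R^-1)%:E.
Proof.
have n0 : (0 < n)%N by rewrite (leq_ltn_trans _ (ltn_ord j)).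
have n0' : 0 < n%:R :> R by rewrite ltr0n.
rewrite /lebesgue01 [LHS]/(mrestr lebesgue_measure _ _) /mrestr setIidl.
  rewrite /subinterval lebesgue_measure_itv /= lte_fin ltr_pM2r ?invr_gt0//.
  rewrite ltr_nat ltnSn -EFinB -mulrBl -[in X in X - _]addn1 natrD.
  by rewrite addrAC subrr add0r mul1r.
move=> t; rewrite /subinterval /= !in_itv /= => /andP[jt tj].
rewrite (le_trans _ jt) ?divr_ge0//= (le_trans (ltW tj))// ler_pdivrMr// mul1r.
by rewrite ler_nat.
Qed.

Lemma Lnorm1_step u : ('N[mu]_1[(fun t => (step u t)%:E)] =
  (n%:R^-1 * \sum_(j < n) `|u j|)%:E)%E.
Proof.
rewrite Lnorm1; under eq_integral.
  move=> t _; rewrite abse_EFin normr_step /step -sumEFin.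
  under eq_bigr do rewrite EFinM.
  over.
rewrite ge0_integral_sum//=; last first.
  move=> j; apply: measurable_funeM; apply/measurable_EFinP.
  by apply: measurable_indic; exact: measurable_subinterval.
rewrite mulr_sumr -sumEFin; apply: eq_bigr => j _.
rewrite ge0_integralZl//=.
  rewrite integral_indic//; last exact: measurable_subinterval.
  by rewrite setIT lebesgue01_subinterval -EFinM mulrC.
apply/measurable_EFinP.
by apply: measurable_indic; exact: measurable_subinterval.
Qed.

Lemma stepB u v t : step u t - step v t = step (fun j => u j - v j) t.
Proof.
by rewrite /step -sumrB; apply: eq_bigr => j _; rewrite mulrBl.
Qed.

End StepFunctions.

(** * Pseudometrics pulled back from finite-dimensional l_1 *)

Section L1Metric.
Context {R : realType} {M : Type}.
Implicit Type rho : M -> M -> R.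

(** Listing the coordinates of a map into l_1 makes sums of metrics into concatenations of lists. *)
Definition l1_metric rho : Prop :=
  exists vs : seq (M -> R), forall a b, rho a b = \sum_(v <- vs) `|v a - v b|.

Lemma l1_metric_sum (I : Type) (r : seq I) (P : pred I) (c : I -> R)
    (rho : I -> M -> M -> R) :
  (forall i, P i -> 0 <= c i) -> (forall i, l1_metric (rho i)) ->
  l1_metric (fun a b => \sum_(i <- r | P i) c i * rho i a b).
Proof.
move=> c0 l1; elim: r => [|i r [vs IH]].
  by exists [::] => a b; rewrite !big_nil.
have [Pi|nPi] := boolP (P i); last first.
  by exists vs => a b; rewrite big_cons (negbTE nPi) IH.
have [us E] := l1 i; exists ([seq (fun a => c i * u a) | u <- us] ++ vs) => a b.
rewrite big_cons Pi big_cat IH /= big_map E mulr_sumr; congr (_ + _).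
by apply: eq_bigr => u _; rewrite -mulrBr normrM ger0_norm// c0.
Qed.

Lemma l1_metric_add rho rho' : l1_metric rho -> l1_metric rho' ->
  l1_metric (fun a b => rho a b + rho' a b).
Proof.
by move=> [us uE] [vs vE]; exists (us ++ vs) => a b; rewrite big_cat uE vE.
Qed.

(** The coordinates are half the indicators of the values of [f]: for two different values exactly
    two of them differ, each by 1/2. *)
Lemma l1_metric_discrete (T : finType) (f : M -> T) :
  l1_metric (fun a b => (f a != f b)%:R).
Proof.
exists [seq (fun a => (f a == t)%:R / 2) | t <- enum T] => a b.
rewrite big_map big_enum /=.
have [fab|fab] := eqVneq (f a) (f b).
  by rewrite big1// => t _; rewrite fab subrr normr0.
rewrite (bigD1 (f a))//= (bigD1 (f b)) /=; last by rewrite eq_sym.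
rewrite big1 => [|t /andP[ta tb]].
  rewrite !eqxx (negbTE fab) eq_sym (negbTE fab) mul0r subr0 sub0r normrN.
  by rewrite ger0_norm ?divr_ge0//=; lra.
by rewrite ![_ == t]eq_sym (negbTE ta) (negbTE tb) subrr normr0.
Qed.

Lemma l1_metric_realized rho : l1_metric rho ->
  exists (s : R) (F : M -> L1 R), 0 < s /\
    forall a b, L1_dist (F a) (F b) = (s * rho a b)%:E.
Proof.
(* The extra coordinate, zero by the default of [nth], keeps [n] positive when [vs] is empty. *)
move=> [vs vE]; set n := (size vs).+1.
pose u a (j : 'I_n) := nth (fun=> 0) vs j a.
have H a : exists F : L1 R, {ae lebesgue01 R, forall t, F t = step (u a) t}.
  apply: L1_class; first exact: measurable_step.
  by rewrite Lnorm1_step ltry.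
have [F FE] := choice H; exists n%:R^-1, F; split.
  by rewrite invr_gt0 ltr0n.
move=> a b; rewrite /L1_dist.
rewrite (Lnorm1_ae_eq (g := fun t => (step (fun j => u a j - u b j) t)%:E)).
- rewrite Lnorm1_step vE; congr (_ * _)%:E.
  rewrite big_ord_recr /= /u nth_default// subrr normr0 addr0.
  by rewrite (big_nth (fun=> 0)) big_mkord.
- apply/measurable_EFinP/measurable_funB; exact: measurable_L1.
- by apply/measurable_EFinP; exact: measurable_step.
- by apply: filterS2 (FE a) (FE b) => t -> ->; rewrite stepB.
Qed.

End L1Metric.

(** * Tours and weighted cuts *)

Section Walks.
Context {R : realType}.

Lemma walk_length_map (T T' : Type) (f : T -> T') (w : T' -> T' -> R) x s :
  walk_length w (f x) (map f s) = walk_length (fun a b => w (f a) (f b)) x s.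
Proof.
elim: s x => [|z s IH] x; rewrite /walk_length ?big_nil //= !big_cons.
by rewrite [X in _ + X]IH.
Qed.

Lemma ler_walk_length (T : eqType) (w w' : T -> T -> R) x s :
  (forall a b, w a b <= w' a b) -> walk_length w x s <= walk_length w' x s.
Proof.
move=> H; elim: s x => [|z s IH] x; rewrite /walk_length ?big_nil //= !big_cons.
by apply: lerD => //; exact: IH.
Qed.

Lemma walk_length_sum (T I : Type) (r : seq I) (w : I -> T -> T -> R) x s :
  walk_length (fun a b => \sum_(i <- r) w i a b) x s =
  \sum_(i <- r) walk_length (w i) x s.
Proof.
elim: s x => [|z s IH] x; rewrite /walk_length /=.
  by rewrite big_nil big1// => i _; rewrite big_nil.
rewrite big_cons [X in _ + X]IH -big_split.
by apply: eq_bigr => i _; rewrite big_cons.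
Qed.

Lemma walk_lengthZ (T : Type) (c : R) (w : T -> T -> R) x s :
  walk_length (fun a b => c * w a b) x s = c * walk_length w x s.
Proof.
elim: s x => [|z s IH] x; rewrite /walk_length /= ?big_nil ?mulr0//.
by rewrite !big_cons [X in _ + X]IH mulrDr.
Qed.

End Walks.

(** * Upper bounds for shortest tours *)

Section TspUpper.
Context {R : realType} {Y : finMetricType R}.
Implicit Types (x y p v : Y) (C : {set Y}).

Lemma tsp_singleton x y : tsp x [set x]%SET y <= mdist x y.
Proof.
have := @tsp_le R Y x [set x]%SET y [:: y].
rewrite walk_length_cons walk_length_nil addr0; apply; split => //.
by move=> c; rewrite !inE => /eqP ->; rewrite eqxx.
Qed.

Lemma tsp_xx0 x C : C \subset [set x]%SET -> tsp x C x = 0.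
Proof.
move=> /fintype.subsetP Cx; apply/eqP; rewrite eq_le tsp_ge0 andbT.
rewrite -(walk_length_nil x); apply: tsp_le; split => // c /Cx.
by rewrite !inE.
Qed.

Lemma tsp_subset x y C C' : C \subset C' -> tsp x C y <= tsp x C' y.
Proof.
move=> /fintype.subsetP CC; have [s [sy Cs] ->] := tspP x C' y.
by apply: tsp_le; split => // c /CC /Cs.
Qed.

(** An optimal tour passes through [p]; the excursion to [v] and back is inserted there. *)
Lemma tsp_detour x C y p v : p \in y |: (x |: C) ->
  tsp x (v |: C) y <= tsp x C y + 2 * mdist p v.
Proof.
move=> pxCy; have [s [sy Cs] ->] := tspP x C y.
have ps : p \in x :: s.
  case/setU1P: pxCy => [->|/setU1P[->|/Cs//]]; first by rewrite -sy mem_last.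
  exact: mem_head.
have [s1 [s2 [es l1]]] : exists s1 s2, s = s1 ++ s2 /\ last x s1 = p.
  by case/splitPl: ps => s1 s2 e; exists s1, s2.
rewrite {}es {ps} last_cat l1 in sy Cs *.
have -> : walk_length mdist x (s1 ++ s2) + 2 * mdist p v =
  walk_length mdist x (s1 ++ [:: v, p & s2]).
  by rewrite !walk_length_cat l1 !walk_length_cons (metric_sym v p); ring.
apply: tsp_le; split; first by rewrite last_cat /=.
move=> c /setU1P[->|/Cs].
  by rewrite in_cons mem_cat !inE eqxx !orbT.
rewrite !in_cons !mem_cat !in_cons => /or3P[->|->|->]; rewrite ?orbT//.
Qed.

(* g collapses a leaf v of a tree onto its neighbour p; a tour of the image is
   repaired by one detour from p to v and back. *)
Lemma tsp_collapse (g : Y -> Y) p v x C y :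
  g v = p -> (forall u, u != v -> g u = u) ->
  tsp x C y <= tsp (g x) (g @: C)%SET (g y) + 2 * mdist p v.
Proof.

move=> gv gE.
have CgC : C \subset v |: (g @: C)%SET.
  apply/fintype.subsetP => c cC; rewrite in_setU1; have [//|cv/=] := eqVneq c v.
  by apply/imsetP; exists c; rewrite ?gE.
(* An end equal to [v] is joined to the tour by a step between [p] and [v], which also visits [v].
   If neither end is [v], a detour is made only when [v] is in [C]. *)
have [xv|xv] := eqVneq x v; have [yv|yv] := eqVneq y v.
- rewrite xv yv gv; apply: le_trans (tsp_triangle v p v CgC) _.
  have := tsp_triangle p p v (finset.subsetUl (g @: C)%SET [set p]%SET).
  have := tsp_singleton v p; have := tsp_singleton p v.
  rewrite (metric_sym v p).
  lra.
- rewrite xv gv gE//; apply: le_trans (tsp_triangle v p y CgC) _.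
  have := tsp_singleton v p; have := mdist_ge0 p v.
  by rewrite (metric_sym v p); lra.
- rewrite yv gv gE//; move: CgC; rewrite finset.setUC => CgC.
  apply: le_trans (tsp_triangle x p v CgC) _.
  rewrite (tsp_sym p [set v]%SET).
  have := tsp_singleton v p; have := mdist_ge0 p v.
  by rewrite (metric_sym v p); lra.
- rewrite !gE//; have [vC|vC] := boolP (v \in C).
    apply: le_trans (tsp_subset x y CgC) _; apply: tsp_detour.
    by rewrite !inE -gv imset_f ?orbT.
  apply: (@le_trans _ _ (tsp x (g @: C)%SET y)).
    apply: tsp_subset; apply/fintype.subsetP => c cC.
    apply/imsetP; exists c => //.
    by rewrite gE//; apply: contraNneq vC => <-.
  by have := mdist_ge0 p v; lra.
Qed.
End TspUpper.

(** * Weighted cuts and their pull-backs *)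

Section Cuts.
Context {R : realType}.

Section CutDist.
Context {T : finType}.
Implicit Types (S C : {set T}) (x y z : T) (cs : seq (R * {set T})).

(** Comparing with [x] alone suffices: if any two of the points lie on different sides, one of them
    is not on the side of [x]. *)
Definition separates S x C y : bool :=
  [exists z in y |: C, (x \in S) != (z \in S)].

Definition cut_dist cs x y : R :=
  \sum_(c <- cs) c.1 * ((x \in c.2) != (y \in c.2))%:R.

(* For the cuts given by the edges of a tree, this is the total weight of the
   subtree spanned by C, x and y. *)
Definition hull_weight cs x C y : R :=
  \sum_(c <- cs) c.1 * (separates c.2 x C y)%:R.

Definition nonneg_weights cs := all (fun c => 0 <= c.1) cs.

Lemma hull_weight_ge0 cs x C y : nonneg_weights cs -> 0 <= hull_weight cs x C y.
Proof.
move=> /allP cs0; rewrite /hull_weight big_seq.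
by apply: sumr_ge0 => c /cs0 c0; rewrite mulr_ge0.
Qed.

(** A walk from [x] that visits a point on the other side of a cut crosses this cut at least once;
    summing over the weighted cuts gives the bound. *)
Lemma hull_weight_le_walk_length cs x C y s : nonneg_weights cs ->
  last x s = y -> {subset C <= x :: s} ->
  hull_weight cs x C y <= walk_length (cut_dist cs) x s.
Proof.
move=> /allP cs0 sy Cs; rewrite /cut_dist walk_length_sum /hull_weight big_seq.
rewrite [leRHS]big_seq; apply: ler_sum => -[w S] /cs0 /= w0.
rewrite walk_lengthZ ler_wpM2l//.
have /= L z : z \in x :: s ->
    ((x \in S) != (z \in S))%:R <=
    walk_length (fun a b => ((a \in S) != (b \in S))%:R : R) x s.
  elim: s x z {sy Cs} => [|u s IH] x z; rewrite /walk_length /= ?big_cons.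
    by rewrite big_nil inE => /eqP ->; rewrite eqxx.
  rewrite in_cons => /predU1P[->|/IH {}IH].
    by rewrite eqxx addr_ge0//; have := IH u u (mem_head _ _); rewrite eqxx.
  apply: (@le_trans _ _ (((x \in S) != (u \in S))%:R +
    ((u \in S) != (z \in S))%:R)); last by rewrite lerD2l.
  by rewrite -natrD ler_nat; do 3!case: (_ \in S).
have [/existsP[z /andP[zyC xz]]|_] := boolP (separates S x C y).
  rewrite -[true]xz; apply: L; case/setU1P: zyC => [->|/Cs//].
  by rewrite -sy mem_last.
by have := L x (mem_head _ _); rewrite eqxx.
Qed.

End CutDist.

Section CutPreim.
Context {T T' : finType} (f : T -> T').
Implicit Type cs : seq (R * {set T'}).

(** Serves two maps: the collapse of a leaf and the map of [X] into a tree. *)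
Definition cuts_preim cs : seq (R * {set T}) :=
  [seq (c.1, f @^-1: (c.2 : {set T'})) | c : R * {set T'} <- cs].

Lemma nonneg_weights_preim cs :
  nonneg_weights cs -> nonneg_weights (cuts_preim cs).
Proof. by rewrite /nonneg_weights all_map. Qed.

Lemma cut_dist_preim cs x y :
  cut_dist (cuts_preim cs) x y = cut_dist cs (f x) (f y).
Proof. by rewrite /cut_dist big_map; apply: eq_bigr => c _; rewrite !inE. Qed.

Lemma hull_weight_preim cs x C y :
  hull_weight (cuts_preim cs) x C y = hull_weight cs (f x) (f @: C)%SET (f y).
Proof.
rewrite /hull_weight big_map; apply: eq_bigr => c _; congr (_ * _%:R).
rewrite /separates -imsetU1 /=; apply: f_equal.
apply/existsP/existsP => -[z] /andP[].
  by rewrite !inE => zC xz; exists (f z); rewrite xz andbT imset_f// !inE.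
by case/imsetP => u uC -> xz; exists u; rewrite !inE in uC xz *; rewrite uC.
Qed.

End CutPreim.

(** * Cut systems, extended leaf by leaf *)

Section CutSystem.
Context {Y : finMetricType R}.
Implicit Types (U C : {set Y}) (x y p v : Y) (cs : seq (R * {set Y})).

(** The invariant of the growth of a tree: only points of [U] are constrained, while [tsp] is still
    taken in all of [Y]. *)
Definition cut_system U cs : Prop :=
  [/\ nonneg_weights cs,
      {in U &, forall x y, mdist x y = cut_dist cs x y}
    & forall x C y, x \in U -> y \in U -> C \subset U ->
        tsp x C y <= 2 * hull_weight cs x C y].

Lemma cut_system1 v : cut_system [set v]%SET [::].
Proof.
split=> //.
  by move=> x y /set1P -> /set1P ->; rewrite mdistxx /cut_dist big_nil.
move=> x C y /set1P -> /set1P -> Cv.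
by rewrite tsp_xx0// mulr_ge0// hull_weight_ge0.
Qed.

Lemma cut_system_leaf U cs p v : cut_system U cs -> p \in U -> v \notin U ->
  {in U, forall u, mdist v u = mdist v p + mdist p u} ->
  exists cs', cut_system (v |: U) cs'.
Proof.
move=> [cs0 csd cst] pU vU vd; pose g u := if u == v then p else u.
have gv : g v = p by rewrite /g eqxx.
have gE u : u != v -> g u = u by rewrite /g => /negbTE ->.
have Uv u : u \in U -> u != v by apply: contraTneq => ->.
have gU u : u \in v |: U -> g u \in U.
  by case/setU1P => [->|uU]; rewrite ?gv// gE// Uv.
(* The new edge cuts off [v] alone; pulling the old cuts back along [g] puts [v] on the side of
   [p]. *)
exists ((mdist v p, [set v]%SET) :: cuts_preim g cs).
have w0 := mdist_ge0 v p; have pr0 := nonneg_weights_preim g cs0.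
split=> [|x y|x C y xU yU CU]; first by rewrite /nonneg_weights /= w0.
- rewrite /cut_dist big_cons -/(cut_dist _ _ _) cut_dist_preim !inE /=.
  have [->|xv] := eqVneq x v; have [->|yv] := eqVneq y v => /= xU yU.
  + by rewrite !mdistxx mulr0 add0r gv -csd// mdistxx.
  + by rewrite gv gE// -csd// mulr1 vd.
  + by rewrite gv gE// -csd// mulr1 (metric_sym x v) (vd x)// (metric_sym x).
  + by rewrite !gE// mulr0 add0r csd.
have CgU : (g @: C)%SET \subset U.
  by apply/fintype.subsetP => _ /imsetP[c cC ->]; apply/gU/(fintype.subsetP CU).
have := cst _ _ _ (gU _ xU) (gU _ yU) CgU.
rewrite /hull_weight big_cons -!/(hull_weight _ _ _ _) hull_weight_preim /=.
(* If the new cut separates, its doubled weight pays for the detour of [tsp_collapse]. If not,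
   either all points are [v] and the tour is trivial, or none is and [g] fixes them. *)
have [sep|nsep] := boolP (separates [set v]%SET x C y).
  have := tsp_collapse x C y gv gE; rewrite (metric_sym p v) mulr1; lra.
rewrite mulr0 add0r.
have {nsep}sv z : z \in y |: C -> (x == v) = (z == v).
  move=> zC; move: nsep; rewrite negb_exists => /forallP/(_ z).
  by rewrite zC /= negbK !inE => /eqP.
have [xv|xv] := eqVneq x v.
  have yv : y = v by apply/eqP; rewrite -sv ?xv// setU11.
  have Cv : C \subset [set v]%SET.
    by apply/fintype.subsetP => z zC; rewrite inE -sv ?xv// setU1r.
  by move=> _; rewrite xv yv tsp_xx0// mulr_ge0// hull_weight_ge0.
have gC z : z \in y |: C -> g z = z by move=> zC; rewrite gE// -sv.
have -> : (g @: C)%SET = C.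
  by rewrite -[RHS]imset_id; apply: eq_in_imset => z zC; rewrite gC// setU1r.
by rewrite (gE x)// gC// setU11.
Qed.

End CutSystem.
End Cuts.

(** * Cuts of a tree *)

Section TreeCuts.
Context {V : finType}.
Implicit Types (e : rel V) (U : {set V}) (p v : V) (s : seq V).

Definition induced e U : rel V := [rel x y | [&& e x y, x \in U & y \in U]].

Definition connected_in e U : Prop :=
  {in U &, forall x y, connect (induced e U) x y}.

Lemma connected_in_add e U p v : symmetric e -> connected_in e U ->
  p \in U -> e v p -> connected_in e (v |: U).
Proof.
move=> se cU pU vp.
have sub x y : x \in U -> y \in U -> connect (induced e (v |: U)) x y.
  move=> xU yU.
  apply: (connect_sub _ (cU _ _ xU yU)) => a b /= /and3P[ab aU bU].
  by apply: connect1; rewrite /induced /= ab !inE aU bU !orbT.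
have cvp : connect (induced e (v |: U)) v p.
  by apply: connect1; rewrite /induced /= vp !inE eqxx pU orbT.
have cpv : connect (induced e (v |: U)) p v.
  by apply: connect1; rewrite /induced /= se vp !inE eqxx pU orbT.
move=> x y /setU1P[->|xU] /setU1P[->|yU].
- exact: connect0.
- exact: connect_trans cvp (sub _ _ pU yU).
- exact: connect_trans (sub _ _ xU pU) cpv.
- exact: sub.
Qed.

(* A path from v to U entering U elsewhere than at p would close a cycle. *)
Lemma acyclic_gateway e U p v s : symmetric e ->
  (forall c, (2 < size c)%N -> ~~ ucycleb e c) -> connected_in e U ->
  p \in U -> v \notin U -> e v p -> path e v s -> last v s \in U -> p \in s.
Proof.
move=> se acyc cU pU vU vp vs sU.
have hs : has (mem U) s.
  case/lastP: s vU sU {vs} => [/negbTE/= ->//|s z _].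
  by rewrite last_rcons has_rcons /= => ->.
(* [b] is the first vertex of the path in [U]; the vertices [s1] before it lie outside [U]. *)
case: (split_find hs) vs => b s1 s2 bU s1U.
have {}bU : b \in U := bU.
rewrite -cats1 -catA cat_path /=.
case/and3P=> vs1 s1b _; rewrite !mem_cat !inE.
have [//|pb] := eqVneq p b; first by rewrite orbT.
exfalso; have /connectP[t bt pt] := cU _ _ bU pU.
case/shortenP: bt pt => t' bt' ut' _ pt'.
case/shortenP: vs1 s1b => s1' vs1' us1' s1's1 s1b.
have tU : all (mem U) (b :: t').
  rewrite /= bU /=; elim: t' b bt' {bU pb ut' pt' s1b} => //= z t' IH b.
  by case/andP=> /and3P[_ _ zU] /IH ->; rewrite [z \in _]zU.
have bt : path e b t' by apply: sub_path bt' => x y /= /and3P[].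
(* The cycle runs from [v] to [b] outside [U], then inside [U] to [p], and back along the edge to
   [v]. As [b] differs from [p], [t'] is nonempty and the cycle has at least three vertices. *)
have /negP : ~~ ucycleb e ((v :: s1') ++ b :: t').
  apply: acyc; case: t' pt' {bt' ut' tU bt} => [/= pb'|z t' _].
    by rewrite pb' eqxx in pb.
  by rewrite size_cat /= addSn !addnS.
apply.
rewrite /ucycleb cat_uniq us1' ut' /= andbT rcons_cat cat_path vs1' /=.
rewrite s1b rcons_path bt -pt' se vp /=.
have disj z : z \in b :: t' -> z \notin v :: s1'.
  move=> /(allP tU) zU; apply: contraL zU => /predU1P[->//|/s1's1 zs1].
  by move/hasPn: s1U; apply.
by rewrite -[_ || _]/(has (mem (v :: s1')) (b :: t')); apply/hasPn.
Qed.

(** On a path leaving [U], take the first vertex outside [U] and its predecessor. *)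
Lemma boundary_edge e U : (forall x y, connect e x y) -> symmetric e ->
  U != finset.set0 -> U != [set: V]%SET ->
  exists p v, [/\ p \in U, v \notin U & e v p].
Proof.
move=> ce se /set0Pn[a aU] UT.
have [b bU] : exists b, b \notin U.
  move: UT; rewrite -finset.properT => /fintype.properP[_ [b _ bU]].
  by exists b.
have /connectP[s as_ bs] := ce a b.
have hs : has (predC (mem U)) s.
  case/lastP: s bs {as_} => [/= ba|s z]; first by rewrite ba aU in bU.
  by rewrite last_rcons has_rcons /= => <-; apply/orP; left.
case: (split_find hs) as_ => v s1 s2 vU /hasPn s1U.
rewrite -cats1 -catA cat_path /= => /and3P[_ pv _].
exists (last a s1), v; split => //; last by rewrite se.
by have /predU1P[->//|/s1U] := mem_last a s1; rewrite /= negbK.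
Qed.

End TreeCuts.

(** A connected vertex set grows from a single vertex by outer ends of boundary edges; each new
    vertex is metrically a leaf, so [cut_system_leaf] applies. *)
Lemma tree_metric_cut_system (R : realType) (V : finMetricType R) :
  tree_metric V -> exists cs, @cut_system R V [set: V]%SET cs.
Proof.
move=> [e [se _ V0 ce acyc] [w [_ _ wmin wE]]].
have lenE x s : path e x s -> walk_length w x s = walk_length mdist x s.
  elim: s x => [|z s IH] x /=; first by rewrite /walk_length !big_nil.
  case/andP=> xz /IH {}IH.
  by rewrite /walk_length /= !big_cons wE// [X in _ + X]IH.
(* A shortest path from [v] to [u] meets [p] by [acyclic_gateway]; splitting it there reverses the
   triangle inequality. *)
have through U p v u : connected_in e U -> p \in U -> v \notin U -> e v p ->
    u \in U -> mdist v u = mdist v p + mdist p u.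
  move=> cU pU vU vp uU; apply/eqP; rewrite eq_le metric_triangle /=.
  have [[s [vs su] <-] _] := wmin v u; rewrite lenE//.
  have ps : p \in v :: s.
    by rewrite in_cons (acyclic_gateway se acyc cU pU vU vp vs) ?orbT// su.
  case/splitPl: ps vs su => s1 s2 s1p _; rewrite last_cat s1p => <-.
  by rewrite walk_length_cat s1p lerD// -?{1}s1p mdist_le_walk_length.
have [r _] : exists r : V, r \in V by apply/card_gt0P.
suff H n : (n < #|V|)%N -> exists (U : {set V}) cs,
    [/\ #|U| = n.+1, connected_in e U & @cut_system R V U cs].
  have [|U [cs [cU _ Ucs]]] := H #|V|.-1; first by rewrite ltn_predL.
  exists cs; rewrite prednK// in cU.
  have <- // : U = [set: V]%SET.
  by apply/eqP; rewrite eqEcard finset.subsetT cardsT cU leqnn.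
elim: n => [_|n IH nV].
  exists [set r]%SET, [::]; rewrite cards1.
  split => //; last exact: cut_system1.
  by move=> x y /set1P -> /set1P ->; exact: connect0.
have [U [cs [cU coU Ucs]]] := IH (ltnW nV).
have [||p [v [pU vU vp]]] := @boundary_edge V e U ce se.
- by rewrite -card_gt0 cU.
- by apply: contraTneq nV => UT; rewrite -cU UT cardsT ltnn.
have [u|cs' Ucs'] := cut_system_leaf Ucs pU vU; first exact: through.
exists (v |: U), cs'; split=> //; first by rewrite cardsU1 vU cU.
exact: connected_in_add vp.
Qed.

(** * Lamplighter metrics *)

Section Lamplighter.
Context {R : realType} {X : finMetricType R}.
Implicit Types (S A C : {set X}) (cs : seq (R * {set X})).

(** Dropping the vertices outside the image of [f] does not lengthen a tour. As [f] is injective,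
    the rest pulls back to a tour in [X], which is no longer than its image. *)
Lemma tsp_dominating (Y : finMetricType R) (f : X -> Y) x C y :
  (forall a b, mdist a b <= mdist (f a) (f b)) ->
  tsp x C y <= tsp (f x) (f @: C)%SET (f y).
Proof.
move=> fd; have [s [sy Cs] ->] := tspP (f x) (f @: C)%SET (f y).
have /map_preim tE : {subset [seq z <- s | z \in codom f] <= codom f}.
  by move=> z; rewrite mem_filter => /andP[].
set t := preim_seq _ _ in tE.
have finj : injective f.
  move=> a b fab; apply/(@mdist_positivity R)/eqP.
  rewrite eq_le mdist_ge0 andbT.
  by rewrite (le_trans (fd a b))// fab mdistxx.
apply: (@le_trans _ _ (walk_length mdist x t)).
  apply: tsp_le; split.
    apply: finj; rewrite -last_map tE; case/lastP: s sy {Cs t tE} => // s z.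
    by rewrite last_rcons filter_rcons => ->; rewrite /= codom_f last_rcons.
  move=> c cC; rewrite -(mem_map finj) /= tE.
  have := Cs _ (imset_f f cC); rewrite !in_cons mem_filter => /predU1P[->|->].
    by rewrite eqxx.
  by rewrite andbT [_ \in _]codom_f orbT.
apply: le_trans (ler_walk_length x t fd) _.
rewrite -(walk_length_map f mdist) tE.
have := walk_length_subseq (f x) (filter_subseq (fun z => z \in codom f) s).
by apply: le_trans; rewrite lerDl mdist_ge0.
Qed.

Definition cut_label S (a : lamplighter X) : bool * {set X} :=
  (a.2 \in S, if a.2 \in S then a.1 :\: S else a.1 :&: S).

(** If the two positions are on the same side, the cut separates exactly when the symmetric
    difference meets the opposite side, where the labels record the lamps. *)
Lemma separates_cut_label S (a b : lamplighter X) :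
  separates S a.2 (symdiff a.1 b.1) b.2 = (cut_label S a != cut_label S b).
Proof.
case: a b => [A x] [B y]; rewrite /separates /cut_label /= xpair_eqE.
have [xy|xy] := eqVneq (x \in S) (y \in S); last first.
  by apply/existsP; exists y; rewrite setU11.
rewrite -xy /=; apply/idP/idP => [/existsP[z /andP[]]|].
  case/setU1P => [->|]; first by rewrite xy eqxx.
  move=> zAB xz; apply: contraL zAB => /eqP/setP/(_ z).
  by move: xz; case: (x \in S); rewrite !inE; case: (z \in S) => //= _;
    case: (z \in A); case: (z \in B).
apply: contraR => /existsPn no; apply/eqP/setP => z; have := no z.
by case: (x \in S); rewrite !inE; case: (z \in S); case: (z \in A);
  case: (z \in B); rewrite //= !orbT.
Qed.

Lemma l1_metric_hull_weight cs : nonneg_weights cs ->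
  l1_metric (fun a b : lamplighter X =>
    hull_weight cs a.2 (symdiff a.1 b.1) b.2).
Proof.
(* Filtering by [0 <= c.1] leaves [cs] unchanged and supplies the sign condition of
   [l1_metric_sum]. *)
move=> /all_filterP csE; have [vs vE] := @l1_metric_sum R (lamplighter X) _ cs
  (fun c => 0 <= c.1) (fun c => c.1)
  (fun c a b => (cut_label c.2 a != cut_label c.2 b)%:R) (fun c c0 => c0)
  (fun c => l1_metric_discrete _).
exists vs => a b; rewrite -vE -big_filter csE /hull_weight.
by apply: eq_bigr => c _; rewrite separates_cut_label.
Qed.

Lemma l1_metric_card_symdiff :
  l1_metric (fun a b : lamplighter X => #|symdiff a.1 b.1|%:R : R).
Proof.
have [vs vE] := @l1_metric_sum R (lamplighter X) _ (enum X) xpredT (fun=> 1)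
  (fun z a b => ((z \in a.1) != (z \in b.1))%:R) (fun _ _ => ler01)
  (fun z => l1_metric_discrete _).
exists vs => a b; rewrite -vE big_enum /= -sum1_card natr_sum big_mkcond /=.
apply: eq_bigr => z _; rewrite mul1r !inE.
by case: (z \in a.1); case: (z \in b.1).
Qed.

Lemma dominating_tree_cuts (Y : finMetricType R) (f : X -> Y) :
  tree_metric Y -> (forall x y, mdist x y <= mdist (f x) (f y)) ->
  exists cs, [/\ nonneg_weights cs,
    forall x y, cut_dist cs x y = mdist (f x) (f y)
    & forall x C y, tsp x C y <= 2 * hull_weight cs x C y].
Proof.
move=> /tree_metric_cut_system[cs [cs0 csd cst]] fd.
exists (cuts_preim f cs); split=> [|x y|x C y].
- exact: nonneg_weights_preim.
- by rewrite cut_dist_preim csd ?inE.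
- rewrite hull_weight_preim; apply: le_trans (tsp_dominating x C y fd) _.
  by apply: cst; rewrite ?inE ?finset.subsetT.
Qed.

End Lamplighter.

Theorem corollary7 (R : realType) (X : finMetricType R) (D : R) :
  1 <= D ->
  stochastic_tree_embeddable X D ->
  bilipschitz_embeds_in_L1 (lamplighter X) (6 * D).
Proof.
move=> D1 [k [p [Y [f [_ p0 p1 Ytree fX]]]]].
have fdom i x y := (fX x y).1 i.
have [cs csP] := choice (fun i => dominating_tree_cuts (Ytree i) (fdom i)).
pose hull i (a b : lamplighter X) :=
  hull_weight (cs i) a.2 (symdiff a.1 b.1) b.2.
(* The factor 2 comes from the bound of [tsp] by twice the hull weight, and makes [rho] dominate the
   lamplighter metric. *)
pose rho (a b : lamplighter X) :=
  \sum_(i < k) (2 * p i) * hull i a b + #|symdiff a.1 b.1|%:R.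
have rho_l1 : l1_metric rho.
  apply: l1_metric_add l1_metric_card_symdiff; apply: l1_metric_sum => i.
    by rewrite mulr_ge0.
  by apply: l1_metric_hull_weight; case: (csP i).
have [s [F [s0 FE]]] := l1_metric_realized rho_l1.
exists s, F; split=> // a b; rewrite FE !lee_fin; set C := symdiff a.1 b.1.
have tsp_hull : tsp a.2 C b.2 <= \sum_(i < k) (2 * p i) * hull i a b.
  rewrite -[leLHS]mul1r -[X in X * tsp _ _ _]p1 mulr_suml.
  apply: ler_sum => i _.
  rewrite (mulrC 2) -mulrA ler_wpM2l//.
  by have [_ _] := csP i; apply.
(* The image of an optimal tour in each tree is at least as long as the hull weight; its average
   length is at most [D] times the length in [X]. *)
have hull_tsp : \sum_(i < k) p i * hull i a b <= D * tsp a.2 C b.2.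
  have [t [tb Ct] ->] := tspP a.2 C b.2.
  rewrite -walk_lengthZ.
  apply: (@le_trans _ _ (walk_length
    (fun x y => \sum_(i < k) p i * mdist (f i x) (f i y)) a.2 t)); last first.
    by apply: ler_walk_length => x y; have [] := fX x y.
  rewrite walk_length_sum; apply: ler_sum => i _.
  rewrite walk_lengthZ ler_wpM2l//.
  have [cs0 csd _] := csP i.
  apply: le_trans (hull_weight_le_walk_length cs0 tb Ct) _.
  by apply: ler_walk_length => x y; rewrite csd.
have cardC : 0 <= #|C|%:R :> R by [].
have T0 := tsp_ge0 a.2 C b.2.
split; first by rewrite ler_wpM2l ?(ltW s0)// lamplighter_mdistE lerD2r.
rewrite [_ * s]mulrC -mulrA ler_wpM2l ?(ltW s0)// lamplighter_mdistE -/C /rho.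
under eq_bigr do rewrite -mulrA.
(* Here [rho] is at most 2 D [tsp] + [#|C|], which is below the required bound since D is at least
   1. *)
rewrite -mulr_sumr -/C; nra.
Qed.
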